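(* Let $\alpha,\beta\in\mathbb{R}$ with $\alpha\neq 0$, and let $G_1$ be the connected, simply connected three-dimensional Lie group with left-invariant Lorentzian metric $g$ whose Lie algebra has a pseudo-orthonormal basis $\{\widetilde e_1,\widetilde e_2,\widetilde e_3\}$, with $\widetilde e_3$ timelike, satisfying $$[\widetilde e_1,\widetilde e_2]=\alpha\widetilde e_1-\beta\widetilde e_3,\quad [\widetilde e_1,\widetilde e_3]=-\alpha\widetilde e_1-\beta\widetilde e_2,\quad [\widetilde e_2,\widetilde e_3]=\beta\widetilde e_1+\alpha\widetilde e_2+\alpha\widetilde e_3.$$ Then the symmetrized Ricci tensor $\widetilde\rho^k$ of the Kobayashi-Nomizu connection $\nabla^k$ is not a Codazzi tensor on $(G_1,\nabla^k)$.
   Context: Basis vectors are identified with left-invariant vector fields on the group $G$; $g(\widetilde e_1,\widetilde e_1)=g(\widetilde e_2,\widetilde e_2)=1$, $g(\widetilde e_3,\widetilde e_3)=-1$, and $g(\widetilde e_i,\widetilde e_j)=0$ for $i\ne j$. Let $\nabla^L$ be the Levi-Civita connection of $g$ and $J$ the product structure on $G$ (a $(1,1)$ tensor field) with $J\widetilde e_1=\widetilde e_1$, $J\widetilde e_2=\widetilde e_2$, $J\widetilde e_3=-\widetilde e_3$. Put $(\nabla^L_XJ)Y=\nabla^L_X(JY)-J\nabla^L_XY$. The canonical connection is $\nabla^c_XY=\nabla^L_XY-\tfrac12(\nabla^L_XJ)JY$, and the Kobayashi-Nomizu connection is $\nabla^k_XY=\nabla^c_XY-\tfrac14[(\nabla^L_YJ)JX-(\nabla^L_{JY}J)X]$.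 Curvature: $R^k(X,Y)Z=\nabla^k_X\nabla^k_YZ-\nabla^k_Y\nabla^k_XZ-\nabla^k_{[X,Y]}Z$. Ricci tensor: $\rho^k(X,Y)=-g(R^k(X,\widetilde e_1)Y,\widetilde e_1)-g(R^k(X,\widetilde e_2)Y,\widetilde e_2)+g(R^k(X,\widetilde e_3)Y,\widetilde e_3)$. Symmetrized Ricci tensor: $\widetilde\rho^k(X,Y)=\tfrac12(\rho^k(X,Y)+\rho^k(Y,X))$. For a linear connection $\nabla$ and a $(0,2)$ tensor field $\omega$: $(\nabla_X\omega)(Y,Z)=X[\omega(Y,Z)]-\omega(\nabla_XY,Z)-\omega(Y,\nabla_XZ)$. The tensor $\omega$ is called a Codazzi tensor on $(G,\nabla)$ if $(\nabla_X\omega)(Y,Z)-(\nabla_Y\omega)(X,Z)=0$ for all vector fields $X,Y,Z$. *)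

(* Defs.v *)
From HB Require Import structures.
From mathcomp Require Import all_boot all_order all_algebra.
From mathcomp Require Import all_classical all_reals all_analysis.
Import Order.TTheory GRing.Theory Num.Theory.
Import numFieldNormedType.Exports.

Set Implicit Arguments.
Unset Strict Implicit.
Unset Printing Implicit Defensive.

Local Open Scope classical_set_scope.
Local Open Scope ring_scope.

Section Ck.
Context {R : realType}.

(* In finite dimension, this is C^k on U when U is open: a map is C^(k+1) iff
   it is differentiable and its derivative along each fixed vector is C^k. *)
Fixpoint Ck {V W : normedModType R} (k : nat) (U : set V) (f : V -> W) :=
  if k is k'.+1 then
    (forall x, U x -> differentiable f x) /\ (forall v, Ck k' U ('D_v f))
  else forall x, U x -> {for x, continuous f}.

Definition Cinf {V W : normedModType R} (U : set V) (f : V -> W) :=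
  forall k, Ck k U f.

Lemma near0_differentiable {V W : normedModType R} (f : V -> W) x :
  (\forall y \near x, f y = 0) -> differentiable f x.
Proof.
move=> f0; have fx0 : f x = 0 by exact: nbhs_singleton f0.
have exp : f \o shift x = cst (f x) + (\0 : V -> W) +o_ 0 id.
  apply/eqaddoP => e e0; rewrite (near_shift 0) in f0.
  apply: filterS f0 => h; rewrite subr0 /= => h0.
  by rewrite !fctE /= h0 fx0 addr0 subrr normr0 mulr_ge0// ltW.
have cont : continuous (\0 : V -> W) by exact: cst_continuous.
apply/diff_locallyP.
have -> : 'd f x = (\0 : {linear V -> W}) :> (V -> W) .
  exact: diff_unique.
by split.
Qed.

Lemma near_eq_differentiable {V W : normedModType R} (f g : V -> W) x :
  (\forall y \near x, f y = g y) -> differentiable f x -> differentiable g x.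
Proof.
move=> fg df; have -> : g = f + (g - f) by rewrite addrC subrK.
apply: differentiableD => //; apply: near0_differentiable.
by apply: filterS fg => y /= e; rewrite !fctE e subrr.
Qed.

Lemma Ck_ext {V W : normedModType R} k (U : set V) (f g : V -> W) :
  open U -> {in U, f =1 g} -> Ck k U f -> Ck k U g.
Proof.
move=> oU; elim: k f g => [|k IH] f g fg /=.
  move=> fc x Ux; have fgx : \forall y \near x, f y = g y.
    by apply: filterS (open_nbhs_nbhs (conj oU Ux)) => y Uy; apply/fg/mem_set.
  rewrite /prop_for /continuous_at -(fg _ (mem_set Ux)).
  exact: cvg_trans (near_eq_cvg fgx) (fc _ Ux).
move=> [df Df].
have fgn x : U x -> \forall y \near x, f y = g y.
  by move=> Ux; apply: filterS (open_nbhs_nbhs (conj oU Ux)) => y Uy;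
     apply/fg/mem_set.
split=> [x Ux|v]; first exact: near_eq_differentiable (fgn _ Ux) (df _ Ux).
apply: IH (Df v) => x /set_mem Ux; exact: near_eq_derive (fgn _ Ux).
Qed.

Lemma Ck_cst {V W : normedModType R} k (U : set V) (c : W) :
  open U -> Ck k U (cst c : V -> W).
Proof.
move=> oU; elim: k c => [|k IH] c /=; first by move=> x _; exact: cst_continuous.
split=> [x _|v]; first exact: differentiable_cst.
by apply: Ck_ext (IH 0) => // x _; rewrite derive_cst.
Qed.

Lemma Ck_derivable {V W : normedModType R} k (U : set V) (f : V -> W) v x :
  Ck k.+1 U f -> U x -> derivable f x v.
Proof. by move=> [df _] Ux; apply/diff_derivable/df. Qed.

Lemma Ck_cont {V W : normedModType R} k (U : set V) (f : V -> W) :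
  Ck k U f -> Ck 0 U f.
Proof.
by case: k => // k [df _] x Ux; apply/differentiable_continuous/df.
Qed.

Lemma CkW {V W : normedModType R} k (U : set V) (f : V -> W) :
  Ck k.+1 U f -> Ck k U f.
Proof.
elim: k f => [|k IH] f; first exact: Ck_cont.
by move=> [df Df]; split=> // v; apply/IH/Df.
Qed.

Lemma CkD {V W : normedModType R} k (U : set V) (f g : V -> W) :
  open U -> Ck k U f -> Ck k U g -> Ck k U (f + g).
Proof.
move=> oU; elim: k f g => [|k IH] f g.
  by move=> /= cf cg x Ux; apply: continuousD; [exact: cf|exact: cg].
move=> Cf Cg; split=> [x Ux|v].
  by apply: differentiableD; [exact: Cf.1|exact: Cg.1].
apply: Ck_ext (IH _ _ (Cf.2 v) (Cg.2 v)) => // x /set_mem Ux.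
by rewrite deriveD//; [exact: Ck_derivable Cf Ux|exact: Ck_derivable Cg Ux].
Qed.

Lemma CkM {V : normedModType R} k (U : set V) (f g : V -> R) :
  open U -> Ck k U f -> Ck k U g -> Ck k U (f * g).
Proof.
move=> oU; elim: k f g => [|k IH] f g.
  by move=> /= cf cg x Ux; apply: continuousM; [exact: cf|exact: cg].
move=> Cf Cg; split=> [x Ux|v].
  by apply: differentiableM; [exact: Cf.1|exact: Cg.1].
have H := CkD oU (IH _ _ (CkW Cf) (Cg.2 v)) (IH _ _ (CkW Cg) (Cf.2 v)).
apply: Ck_ext H => // x /set_mem Ux.
by rewrite deriveM//; [exact: Ck_derivable Cf Ux|exact: Ck_derivable Cg Ux].
Qed.

End Ck.

Section Charts.
Context {R : realType} {n : nat} {M : topologicalType}.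

(* [cinv] is only meaningful on the open set [ccod], the image of [cdom]. *)
Record chart := Chart {
  cdom : set M;
  ccod : set 'rV[R]_n;
  cmap : M -> 'rV[R]_n;
  cinv : 'rV[R]_n -> M;
  cdom_open : open cdom;
  ccod_open : open ccod;
  cmap_cod : forall p, cdom p -> ccod (cmap p);
  cinv_dom : forall x, ccod x -> cdom (cinv x);
  cmapK : forall p, cdom p -> cinv (cmap p) = p;
  cinvK : forall x, ccod x -> cmap (cinv x) = x;
  cmap_cont : forall p, cdom p -> {for p, continuous cmap};
  cinv_cont : forall x, ccod x -> {for x, continuous cinv}
}.

Definition chart_compatible (c d : chart) :=
  Cinf (ccod c `&` cinv c @^-1` cdom d) (cmap d \o cinv c).

End Charts.
Arguments chart R n M : clear implicits.

HB.mixin Record isManifold (R : realType) (n : nat) M of Topological M := {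
  atlas : set (chart R n M);
  atlas_cover : forall p : M, exists2 c, atlas c & cdom c p;
  atlas_compatible :
    forall c d, atlas c -> atlas d -> chart_compatible c d;
  manifold_hausdorff : hausdorff_space M;
  manifold_second_countable : @second_countable M
}.

#[short(type="manifoldType")]
HB.structure Definition Manifold (R : realType) (n : nat) :=
  {M of isManifold R n M & Topological M}.

Arguments atlas {R n} M : rename.

Section SmoothFun.
Context {R : realType} {n : nat} (M : manifoldType R n).

Definition smooth : {pred M -> R} :=
  mem [set f : M -> R | forall c, atlas M c -> Cinf (ccod c) (f \o cinv c)].

Record smoothfun := SmoothFun {
  smoothfun_val :> M -> R;
  _ : smoothfun_val \in smooth
}.

HB.instance Definition _ := [isSub for smoothfun_val].
HB.instance Definition _ := [Choice of smoothfun by <:].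

Let smooth_cst (a : R) : cst a \in smooth.
Proof. by apply/mem_set => c _ k; exact/Ck_cst/ccod_open. Qed.

Let smoothD (f g : M -> R) : f \in smooth -> g \in smooth -> f + g \in smooth.
Proof.
move=> /set_mem Sf /set_mem Sg; apply/mem_set => c Ac k.
by apply: CkD; [exact: ccod_open|exact: Sf|exact: Sg].
Qed.

Let smoothM (f g : M -> R) : f \in smooth -> g \in smooth -> f * g \in smooth.
Proof.
move=> /set_mem Sf /set_mem Sg; apply/mem_set => c Ac k.
by apply: CkM; [exact: ccod_open|exact: Sf|exact: Sg].
Qed.

Let smoothZ (a : R) (f : M -> R) : f \in smooth -> a *: f \in smooth.
Proof. by move=> Sf; exact: smoothM (smooth_cst a) Sf. Qed.

Let smooth_subring : subring_closed smooth.
Proof.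
split; [exact: smooth_cst| |exact: smoothM] => f g Sf Sg.
by apply: smoothD => //; rewrite -scaleN1r; exact: smoothZ.
Qed.

Let smooth_scale : scaler_closed smooth.
Proof. by move=> a f; exact: smoothZ. Qed.

HB.instance Definition _ := GRing.isSubringClosed.Build _ smooth smooth_subring.
HB.instance Definition _ := GRing.isScaleClosed.Build _ _ smooth smooth_scale.
HB.instance Definition _ := 
  GRing.SubChoice_isSubComPzRing.Build _ _ smoothfun smooth_subring.
HB.instance Definition _ := [SubZmodule_isSubLmodule of smoothfun by <:].

Definition cstf (a : R) : smoothfun := SmoothFun (smooth_cst a).

End SmoothFun.
Arguments cstf {R n M} a.


Section VectorFields.
Context {R : realType} {n : nat} (M : manifoldType R n).
Local Notation sfun := (smoothfun M).

(* Vector fields on [M] are the derivations of its algebra of smooth functions;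
   they form a module over this algebra. *)
Record vfield := VField {
  vfield_fun :> sfun -> sfun;
  vfieldP : linear vfield_fun;
  vfieldM : forall f h,
    vfield_fun (f * h) = f * vfield_fun h + h * vfield_fun f
}.

Lemma vfield_ext (X Y : vfield) : X =1 Y -> X = Y.
Proof.
case: X Y => [X lX mX] [Y lY mY] /= /funext XY.
by case: _ / XY lY mY => lY mY; congr VField; exact: Prop_irrelevance.
Qed.

HB.instance Definition _ := gen_eqMixin vfield.
HB.instance Definition _ := gen_choiceMixin vfield.

Lemma vfieldD (X : vfield) f h : X (f + h) = X f + X h.
Proof. by have := vfieldP X 1 f h; rewrite !scale1r. Qed.

Lemma vfieldZ (X : vfield) a f : X (a *: f) = a *: X f.
Proof.
have X0 : X 0 = 0.
  by apply: (@addrI _ (X 0)); rewrite -vfieldD !addr0.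
by have := vfieldP X a f 0; rewrite X0 !addr0.
Qed.

Lemma sfun_scaleAr (a : R) (f h : sfun) : f * (a *: h) = a *: (f * h).
Proof. by apply/val_inj/funext => p; exact: mulrCA. Qed.

Definition vfield_zero : vfield.
Proof.
apply: (@VField (fun=> 0)) => [a f h|f h]; first by rewrite scaler0 addr0.
by rewrite !mulr0 addr0.
Defined.

Definition vfield_opp (X : vfield) : vfield.
Proof.
apply: (@VField (fun f => - X f)) => [a f h|f h].
  by rewrite vfieldP opprD scalerN.
by rewrite vfieldM opprD !mulrN.
Defined.

Definition vfield_add (X Y : vfield) : vfield.
Proof.
apply: (@VField (fun f => X f + Y f)) => [a f h|f h].
  by rewrite !vfieldP scalerDr addrACA.
by rewrite !vfieldM !mulrDr addrACA.
Defined.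

Definition vfield_scale (u : sfun) (X : vfield) : vfield.
Proof.
apply: (@VField (fun f => u * X f)) => [a f h|f h].
  by rewrite vfieldP mulrDr sfun_scaleAr.
by rewrite vfieldM mulrDr mulrCA [u * (h * _)]mulrCA.
Defined.

Lemma lie_bracket_subproof (X Y : vfield) (f h : sfun) :
  X (Y (f * h)) - Y (X (f * h)) =
  f * (X (Y h) - Y (X h)) + h * (X (Y f) - Y (X f)).
Proof.
have XY (Z W : vfield) : Z (W (f * h)) =
    f * Z (W h) + h * Z (W f) + (Z f * W h + W f * Z h).
  by rewrite vfieldM vfieldD !vfieldM addrACA [W h * _]mulrC.
by rewrite !XY [Y f * X h + _]addrC opprD [LHS]addrACA subrr addr0 opprD addrACA -!mulrBr.
Qed.

Definition lie_bracket (X Y : vfield) : vfield.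
Proof.
apply: (@VField (fun f => X (Y f) - Y (X f))) => [a f h|f h].
  by rewrite !vfieldP opprD addrACA scalerBr.
exact: lie_bracket_subproof.
Defined.

Let addA : associative vfield_add.
Proof. by move=> X Y Z; apply: vfield_ext => f; exact: addrA. Qed.
Let addC : commutative vfield_add.
Proof. by move=> X Y; apply: vfield_ext => f; exact: addrC. Qed.
Let add0 : left_id vfield_zero vfield_add.
Proof. by move=> X; apply: vfield_ext => f; exact: add0r. Qed.
Let addN : left_inverse vfield_zero vfield_opp vfield_add.
Proof. by move=> X; apply: vfield_ext => f; exact: addNr. Qed.

HB.instance Definition _ := GRing.isZmodule.Build vfield addA addC add0 addN.

Let scaleA u v X : vfield_scale u (vfield_scale v X) = vfield_scale (u * v) X.
Proof. by apply: vfield_ext => f; exact: mulrA. Qed.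
Let scale1 : left_id 1 vfield_scale.
Proof. by move=> X; apply: vfield_ext => f; exact: mul1r. Qed.
Let scaleDr : right_distributive vfield_scale +%R.
Proof. by move=> u X Y; apply: vfield_ext => f; exact: mulrDr. Qed.
Let scaleDl X : {morph vfield_scale^~ X : u v / u + v}.
Proof. by move=> u v; apply: vfield_ext => f; exact: mulrDl. Qed.

HB.instance Definition _ :=
  GRing.Zmodule_isLmodule.Build sfun vfield scaleA scale1 scaleDr scaleDl.

(* [X] and [Y] are F-related, for [F] smooth. The function [h] in the
   definition is the pullback of [f], always smooth for such an [F]. *)
Definition related (F : M -> M) (X Y : vfield) :=
  forall f h : sfun, h =1 f \o F -> X h =1 Y f \o F.

End VectorFields.

Section Tensors.
Context {R : realType} {n : nat} {M : manifoldType R n}.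
Local Notation sfun := (smoothfun M).
Local Notation VF := (vfield M).
Implicit Types (X Y Z : VF) (nabla : VF -> VF -> VF) (g omega : VF -> VF -> sfun)
  (J : VF -> VF).

Definition tensor11 J := linear J.

Definition tensor02 omega :=
  (forall X, scalar (omega X)) /\ (forall Y, scalar (omega ^~ Y)).

Definition lorentz_sign (i : 'I_n) : R := if i.+1 == n then -1 else 1.

(* [E] induces a pseudo-orthonormal basis of the tangent space at [p], with
   signs (+, ..., +, -). *)
Definition pseudo_orthonormal_at g (p : M) (E : 'I_n -> VF) :=
  (forall i j, g (E i) (E j) p = if i == j then lorentz_sign i else 0) /\
  (forall X, exists c : 'I_n -> R,
     forall f : sfun, X f p = \sum_i c i * E i f p).

Definition lorentzian g :=
  [/\ tensor02 g, (forall X Y, g X Y = g Y X) &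
      forall p, exists E, pseudo_orthonormal_at g p E].

Definition connection nabla :=
  [/\ (forall Y, linear (nabla ^~ Y)),
      (forall X Y Z, nabla X (Y + Z) = nabla X Y + nabla X Z) &
      (forall X (f : sfun) Y, nabla X (f *: Y) = X f *: Y + f *: nabla X Y)].

Definition torsion_free nabla :=
  forall X Y, nabla X Y - nabla Y X = lie_bracket X Y.

Definition nabla02 nabla omega X Y Z : sfun :=
  X (omega Y Z) - omega (nabla X Y) Z - omega Y (nabla X Z).

Definition levi_civita g nabla :=
  [/\ connection nabla, torsion_free nabla &
      forall X Y Z, nabla02 nabla g X Y Z = 0].

Definition codazzi nabla omega :=
  forall X Y Z, nabla02 nabla omega X Y Z - nabla02 nabla omega Y X Z = 0.

Definition product_structure J :=
  [/\ tensor11 J, (forall X, J (J X) = X) & ~ (J =1 id) /\ ~ (J =1 -%R)].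

Definition nabla11 nabla J X Y : VF := nabla X (J Y) - J (nabla X Y).

Definition canonical_connection nablaL J X Y : VF :=
  nablaL X Y - cstf 2^-1 *: nabla11 nablaL J X (J Y).

Definition kobayashi_nomizu nablaL J X Y : VF :=
  canonical_connection nablaL J X Y -
  cstf 4^-1 *: (nabla11 nablaL J Y (J X) - nabla11 nablaL J (J Y) X).

Definition curvature nabla X Y Z : VF :=
  nabla X (nabla Y Z) - nabla Y (nabla X Z) - nabla (lie_bracket X Y) Z.

End Tensors.

HB.mixin Record isLieGroup (R : realType) (n : nat) G
    of Group G & Manifold R n G := {
  mulg_continuous : continuous (fun xy : G * G => (xy.1 * xy.2)%g);
  invg_continuous : continuous (fun x : G => x^-1%g);
  mulg_smooth : forall a b c : chart R n G,
    atlas G a -> atlas G b -> atlas G c ->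
    Cinf [set xy : 'rV[R]_n * 'rV[R]_n |
            [/\ ccod a xy.1, ccod b xy.2 &
                cdom c (cinv a xy.1 * cinv b xy.2)%g]]
         (fun xy => cmap c (cinv a xy.1 * cinv b xy.2)%g);
  invg_smooth : forall a b : chart R n G, atlas G a -> atlas G b ->
    Cinf [set x | ccod a x /\ cdom b (cinv a x)^-1%g]
         (fun x => cmap b (cinv a x)^-1%g)
}.

#[short(type="lieGroupType")]
HB.structure Definition LieGroup (R : realType) (n : nat) :=
  {G of isLieGroup R n G & Group G & Manifold R n G}.

Section LieGroups.
Context {R : realType} {n : nat} {G : lieGroupType R n}.
Local Notation VF := (vfield G).

Definition ltrans (a x : G) : G := (a * x)%g.

Definition left_invariant (X : VF) := forall a : G, related (ltrans a) X X.

Definition left_invariant_metric (g : VF -> VF -> smoothfun G) :=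
  forall (a : G) (X Y X' Y' : VF),
    related (ltrans a) X X' -> related (ltrans a) Y Y' ->
    g X Y =1 g X' Y' \o ltrans a.

Definition lie_algebra_basis k (e : k.-tuple VF) :=
  (forall i, left_invariant (tnth e i)) /\
  (forall X, left_invariant X ->
     exists! c : 'rV[R]_k, X = \sum_i cstf (c 0 i) *: tnth e i).

End LieGroups.

(* Every loop is contractible relative to its base point; (path-)connectedness
   is not included. *)
Definition simply_connected {R : realType} (T : topologicalType) :=
  forall gamma : R -> T, {within `[0, 1], continuous gamma} ->
    gamma 0 = gamma 1 ->
    exists H : R * R -> T,
      [/\ {within `[0, 1] `*` `[0, 1], continuous H},
          (forall t, 0 <= t <= 1 -> H (0, t) = gamma t),
          (forall t, 0 <= t <= 1 -> H (1, t) = gamma 0) &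
          (forall s, 0 <= s <= 1 -> H (s, 0) = gamma 0 /\ H (s, 1) = gamma 0)].
Arguments simply_connected R T : clear implicits.

Section Dim3.
Context {R : realType} {M : manifoldType R 3}.
Local Notation VF := (vfield M).

(* The sign conventions are those of a pseudo-orthonormal frame (e1, e2, e3)
   with e3 timelike. *)
Definition ricci (g : VF -> VF -> smoothfun M) (nabla : VF -> VF -> VF)
    (e1 e2 e3 X Y : VF) : smoothfun M :=
  - g (curvature nabla X e1 Y) e1 - g (curvature nabla X e2 Y) e2
  + g (curvature nabla X e3 Y) e3.

Definition sym_ricci g nabla e1 e2 e3 X Y : smoothfun M :=
  2^-1 *: (ricci g nabla e1 e2 e3 X Y + ricci g nabla e1 e2 e3 Y X).

End Dim3.

(* Main.v *)
Require Import Defs.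
From HB Require Import structures.
From mathcomp Require Import all_boot all_order all_algebra.
From mathcomp Require Import all_classical all_reals all_analysis.
From mathcomp Require Import ring.
Import Order.TTheory GRing.Theory Num.Theory.
Import numFieldNormedType.Exports.

Local Open Scope classical_set_scope.
Local Open Scope ring_scope.

(** In the frame (e1, e2, e3) the metric, the brackets and J have constant
    coefficients, so the theorem should be a finite computation: Koszul's
    formula gives the Levi-Civita connection on the frame, then come the
    Kobayashi-Nomizu connection nabla, its curvature and the symmetrized Ricci
    tensor r, and finally

      (nabla_e1 r)(e3, e1) - (nabla_e3 r)(e1, e1) = - (3/2) alpha^3,

    which is nonzero.  Since alpha <> 0 this refutes the Codazzi equation.

    The point that needs an argument is that a field is determined by its
    products with e1, e2, e3.  Vector fields are derivations here, and tensors
    are maps that are linear over smooth functions, so neither is known to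
    have values at a point.  It is enough for the present purpose that
    X = sum_i eps_i g(X, e_i) e_i holds where some function u does not vanish,
    u being not identically zero; this is [orthonormal_expansion], and u is a
    determinant det (e_i f_j).

    - Such a determinant can be chosen nonzero ([orthogonal_det_neq0]).
      Expanding a determinant of size k + 1 along the column of one function h
      makes it a derivation of h, a combination of the fields whose
      coefficients are minors of size k ([minor_field]).  If all
      determinants of size k + 1 vanished, this combination would be zero,
      and pairing it with one of the orthogonal fields would kill a nonzero
      minor of size k.
    - Determinants of size 4 vanish, since at each point the derivations span
      at most three dimensions ([minor_field_eq0]).  Applied to X, e1, e2, e3
      this is Cramer's rule, u X = sum_i N_i e_i, and pairing with e_i
      identifies N_i.

    All the operations involved are local: an identity that holds after
    multiplication by u is preserved by derivations and by connections in both
    arguments ([vfield_local], [connection_localr], [connection_locall]).  So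
    one may compute with the coordinate vectors in R^3 of the fields, up to
    the factor u, which is removed at the very end at a point where u does not
    vanish. *)

Set Implicit Arguments.
Unset Strict Implicit.
Unset Printing Implicit Defensive.

(** * Smooth functions and derivations *)

Section Pointwise.
Context {R : realType} {n : nat} {M : manifoldType R n}.
Local Notation sfun := (smoothfun M).
Local Notation VF := (vfield M).

Lemma sfunP (f h : sfun) : f =1 h -> f = h.
Proof. by move=> fh; apply/val_inj/funext. Qed.

(** Evaluation is named so that it can carry the structure of a ring morphism:
    determinants of smooth functions are then computed pointwise. *)
Definition evalp (p : M) (f : sfun) : R := f p.

Lemma evalp_is_zmod_morphism p : zmod_morphism (evalp p).
Proof. by []. Qed.

Lemma evalp_is_monoid_morphism p : monoid_morphism (evalp p).
Proof. by []. Qed.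

HB.instance Definition _ p :=
  GRing.isZmodMorphism.Build sfun R (evalp p) (evalp_is_zmod_morphism p).
HB.instance Definition _ p :=
  GRing.isMonoidMorphism.Build sfun R (evalp p) (evalp_is_monoid_morphism p).

Lemma cstf0 : cstf 0 = 0 :> sfun. Proof. exact: sfunP. Qed.
Lemma cstf1 : cstf 1 = 1 :> sfun. Proof. exact: sfunP. Qed.
Lemma cstfN a : cstf (- a) = - cstf a :> sfun. Proof. exact: sfunP. Qed.
Lemma cstfD a b : cstf (a + b) = cstf a + cstf b :> sfun.
Proof. exact: sfunP. Qed.
Lemma cstfM a b : cstf (a * b) = cstf a * cstf b :> sfun.
Proof. exact: sfunP. Qed.
Lemma cstfZ a (f : sfun) : a *: f = cstf a * f.
Proof. exact: sfunP. Qed.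

Lemma vfield_cst (X : VF) a : X (cstf a) = 0.
Proof.
have X1 : X 1 = 0.
  by apply: (@addrI _ (X 1)); rewrite -{3}[1]mulr1 vfieldM !mul1r addr0.
by rewrite -[cstf a]mulr1 -cstfZ vfieldZ X1 scaler0.
Qed.

Lemma vfield_sumE k (Z : 'I_k -> VF) (f : sfun) :
  (\sum_i Z i) f = \sum_i Z i f.
Proof. by apply: (big_morph (fun X : VF => X f)). Qed.

Lemma vfield_scaleE (u : sfun) (X : VF) (f : sfun) : (u *: X) f = u * X f.
Proof. by []. Qed.

Lemma vfield_addE (X Y : VF) (f : sfun) : (X + Y) f = X f + Y f.
Proof. by []. Qed.

Lemma vfield_oppE (X : VF) (f : sfun) : (- X) f = - X f.
Proof. by []. Qed.

Lemma covecD (phi : VF -> sfun) X Y : scalar phi -> phi (X + Y) = phi X + phi Y.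
Proof. by move=> phil; have := phil 1 X Y; rewrite scale1r mul1r. Qed.

Lemma covec0 (phi : VF -> sfun) : scalar phi -> phi 0 = 0.
Proof.
by move=> phil; apply: (@addrI _ (phi 0)); rewrite -covecD// !addr0.
Qed.

Lemma covecZ (phi : VF -> sfun) u X : scalar phi -> phi (u *: X) = u * phi X.
Proof. by move=> phil; have := phil u X 0; rewrite covec0// !addr0. Qed.

Lemma covec_sum (phi : VF -> sfun) k (c : 'I_k -> sfun) (X : 'I_k -> VF) :
  scalar phi -> phi (\sum_i c i *: X i) = \sum_i c i * phi (X i).
Proof.
move=> phil; rewrite (big_morph phi (fun X Y => covecD X Y phil) (covec0 phil)).
by apply: eq_bigr => i _; rewrite covecZ.
Qed.

End Pointwise.

(** * Determinants of derivatives and expansion in an orthonormal family *)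

Section Minors.
Context {R : realType} {n : nat} {M : manifoldType R n}.
Local Notation sfun := (smoothfun M).
Local Notation VF := (vfield M).

Definition deriv_mx m k (E : 'I_m -> VF) (f : 'I_k -> sfun) : 'M[sfun]_(m, k) :=
  \matrix_(i, j) E i (f j).

Definition fcons k (h : sfun) (f : 'I_k -> sfun) (j : 'I_k.+1) : sfun :=
  if unlift ord0 j is Some j' then f j' else h.

(** The minors are those of the k + 1 by k matrix of the E_i f_j, one row being
    deleted: they are the cofactors of a column that does not enter them. *)
Definition minor_field k (E : 'I_k.+1 -> VF) (f : 'I_k -> sfun) : VF :=
  \sum_(i < k.+1) ((-1) ^+ i * \det (row' i (deriv_mx E f))) *: E i.

(** Laplace expansion along the column of h, the only one that depends on h. *)
Lemma minor_fieldE k (E : 'I_k.+1 -> VF) f (h : sfun) :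
  minor_field E f h = \det (deriv_mx E (fcons h f)).
Proof.
rewrite vfield_sumE (expand_det_col _ ord0); apply: eq_bigr => i _.
have -> : cofactor (deriv_mx E (fcons h f)) i ord0 =
    (-1) ^+ i * \det (row' i (deriv_mx E f)).
  rewrite /cofactor -[X in (-1) ^+ X]/(i + 0)%N addn0; do 2!f_equal.
  by apply/matrixP => a b; rewrite !mxE /fcons liftK.
by rewrite mxE /fcons unlift_none vfield_scaleE [RHS]mulrC.
Qed.

Lemma row'0_deriv_mx k (E : 'I_k.+1 -> VF) (f : 'I_k -> sfun) :
  row' ord0 (deriv_mx E f) = deriv_mx (E \o lift ord0) f.
Proof. by apply/matrixP => a b; rewrite !mxE. Qed.

(** Induction on the number of fields.  The smooth functions have zero divisors,
    but the squares g(E_i, E_i) are nonzero constants, so that pairing with E_0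
    still recovers the vanishing of the coefficient of E_0.  The point p0 only
    serves to have 1 <> 0, which is the determinant of size 0. *)
Lemma orthogonal_det_neq0 (p0 : M) (g : VF -> VF -> sfun) k (E : 'I_k -> VF)
    (s : 'I_k -> R) :
  (forall Y, scalar (g ^~ Y)) -> (forall i, s i != 0) ->
  (forall i j, g (E i) (E j) = if i == j then cstf (s i) else 0) ->
  exists f : 'I_k -> sfun, \det (deriv_mx E f) <> 0.
Proof.
move=> glin; elim: k E s => [|k IH] E s s0 gE.
  exists (fun=> 0); rewrite det_mx00 => /(congr1 (evalp p0)).
  by rewrite rmorph1 rmorph0 => /eqP; rewrite oner_eq0.
have [|i j|f Df] := IH (E \o lift ord0) (s \o lift ord0).
- by move=> i; exact: s0.
- by rewrite gE (inj_eq lift_inj).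
(* The minor of size k is the coefficient of E_0 in the minor field. *)
apply: contrapT => /forallNP det0.
have mf0 : minor_field E f = 0.
  by apply: vfield_ext => h; rewrite minor_fieldE; apply: contrapT => /det0.
apply: Df; have := covec0 (glin (E ord0)).
rewrite -mf0 (covec_sum _ _ (glin (E ord0))) (bigD1 ord0)//=.
rewrite big1 => [|i i0]; last by rewrite gE (negbTE i0) mulr0.
rewrite addr0 gE eqxx expr0 mul1r row'0_deriv_mx => D0.
apply: sfunP => p; apply/eqP; have /eqP := congr1 (evalp p) D0.
by rewrite rmorphM mulf_eq0 (negbTE (s0 _ : evalp p (cstf _) != 0)) orbF.
Qed.

Definition spanned_pointwise (k : nat) :=
  forall p : M, exists E : 'I_k -> VF, forall X : VF, exists c : 'I_k -> R,
     forall f : sfun, X f p = \sum_i c i * E i f p.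

(** At p the matrix of the determinant factors through R^k, hence has rank at
    most k, one less than its size. *)
Lemma minor_field_eq0 k (E : 'I_k.+1 -> VF) (f : 'I_k -> sfun) :
  spanned_pointwise k -> minor_field E f = 0.
Proof.
move=> sp; apply: vfield_ext => h; rewrite minor_fieldE; apply: sfunP => p.
rewrite -[LHS]/(evalp p _) -det_map_mx.
have [B BE] := sp p; have [c cE] := choice (fun i => BE (E i)).
(* The left factor holds the coordinates of the E_i at p in the spanning
   family B. *)
rewrite (_ : map_mx _ _ = (\matrix_(i, j) c i j) *m
    map_mx (evalp p) (deriv_mx B (fcons h f))); last first.
  apply/matrixP => i j; rewrite !mxE [LHS]cE; apply: eq_bigr => l _.
  by rewrite !mxE.
apply/eqP; apply: contraT; rewrite -unitfE -unitmxE -row_free_unit /row_free.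
move=> /eqP rk; have := mulmx_max_rank (\matrix_(i, j) c i j)
  (map_mx (evalp p) (deriv_mx B (fcons h f))).
by rewrite rk ltnn.
Qed.

Definition icons k (X : VF) (E : 'I_k -> VF) (i : 'I_k.+1) : VF :=
  if unlift ord0 i is Some i' then E i' else X.

Lemma icons0 k X (E : 'I_k -> VF) : icons X E ord0 = X.
Proof. by rewrite /icons unlift_none. Qed.

Lemma iconsS k X (E : 'I_k -> VF) i : icons X E (lift ord0 i) = E i.
Proof. by rewrite /icons liftK. Qed.

(** Cramer's rule.  The factor u is there because the E_i may a priori become
    dependent at some points: excluding this would require that the value of g
    at a point depend only on the values of its arguments there. *)
Lemma orthonormal_expansion (p0 : M) (g : VF -> VF -> sfun) (E : 'I_n -> VF) :
  lorentzian g ->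
  (forall i j, g (E i) (E j) = if i == j then cstf (lorentz_sign i) else 0) ->
  exists u : sfun, u <> 0 /\ forall X : VF,
    u *: X = u *: \sum_i (cstf (lorentz_sign i) * g X (E i)) *: E i.
Proof.
move=> [[_ glin] _ gp] gE.
have s0 (i : 'I_n) : lorentz_sign i != 0 :> R.
  by rewrite /lorentz_sign; case: ifP; rewrite ?oppr_eq0 oner_eq0.
have [f Df] := orthogonal_det_neq0 p0 glin s0 gE.
have sp : spanned_pointwise n by move=> p; have [F []] := gp p; exists F.
exists (\det (deriv_mx E f)); split=> // X.
(* The n + 1 fields X, E_1, ..., E_n are dependent over the smooth functions. *)
have := @minor_field_eq0 _ (icons X E) f sp.
have E0 : icons X E \o lift ord0 = E by apply/funext => i; exact: iconsS.
rewrite /minor_field big_ord_recl expr0 mul1r row'0_deriv_mx E0 icons0.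
under eq_bigr do rewrite iconsS.
pose N i :=
  (-1) ^+ lift ord0 i * \det (row' (lift ord0 i) (deriv_mx (icons X E) f)).
rewrite -[X in _ + X]/(\sum_i N i *: E i) => /eqP.
rewrite addr_eq0 -sumrN => /eqP DX.
have {}DX : \det (deriv_mx E f) *: X = \sum_i - N i *: E i.
  by rewrite DX; apply: eq_bigr => i _; rewrite scaleNr.
(* Pairing DX with E_i isolates N_i, up to the sign g(E_i, E_i). *)
have NE i : - N i = \det (deriv_mx E f) * (cstf (lorentz_sign i) * g X (E i)).
  have := congr1 (g ^~ (E i)) DX.
  rewrite (covecZ _ _ (glin _)) (covec_sum _ _ (glin _)) (bigD1 i)//=.
  rewrite big1 => [|j ji]; last by rewrite gE (negbTE ji) mulr0.
  rewrite gE eqxx addr0 mulrCA => ->; rewrite mulrCA -cstfM /lorentz_sign.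
  by case: ifP => _; rewrite ?mulrNN mulr1 cstf1 mulr1.
rewrite DX scaler_sumr; apply: eq_bigr => i _.
by rewrite NE scalerA.
Qed.

End Minors.

(** * Locality of derivations and connections, Koszul's formula *)

Section Locality.
Context {R : realType} {n : nat} {M : manifoldType R n}.
Local Notation sfun := (smoothfun M).
Local Notation VF := (vfield M).
Implicit Types (u : sfun) (X Y Z W : VF).

(** The values are real numbers, so u (u f) and u f vanish at the same points;
    this is what allows a single factor u below instead of increasing powers. *)
Lemma sfun_sqr_cancel u (f : sfun) : u * (u * f) = 0 -> u * f = 0.
Proof.
move=> uuf; apply: sfunP => p; have /eqP := congr1 (evalp p) uuf.
rewrite !rmorphM mulf_eq0 => /orP[/eqP u0|/eqP //].
by rewrite -[LHS]/(evalp p _) rmorphM u0 mul0r.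
Qed.

Lemma vfield_sqr_cancel u X : u *: (u *: X) = 0 -> u *: X = 0.
Proof.
move=> uuX; apply: vfield_ext => f; apply: sfun_sqr_cancel.
by rewrite -!vfield_scaleE uuX.
Qed.

(** By the Leibniz rule for X (u f) the two sides agree after multiplication by
    u^2, hence already by u. *)
Lemma vfield_local X u (f h : sfun) : u * f = u * h -> u * X f = u * X h.
Proof.
move=> ufh; apply/eqP; rewrite -subr_eq0 -mulrBr; apply/eqP/sfun_sqr_cancel.
have XB : X (u * f) = X (u * h) by rewrite ufh.
move: XB; rewrite !vfieldM => /(congr1 ( *%R u)); rewrite !mulrDr.
rewrite ![u * (_ * X u)]mulrA ufh => /addIr uu.
by rewrite uu !mulrN subrr.
Qed.

Lemma vf_linearD (F : VF -> VF) X Y : linear F -> F (X + Y) = F X + F Y.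
Proof. by move=> Fl; have := Fl 1 X Y; rewrite !scale1r. Qed.

Lemma vf_linearZ (F : VF -> VF) u X : linear F -> F (u *: X) = u *: F X.
Proof.
move=> Fl; have F0 : F 0 = 0.
  by apply: (@addrI _ (F 0)); rewrite -vf_linearD// !addr0.
by have := Fl u X 0; rewrite F0 !addr0.
Qed.

Lemma connection_localr nabla X u Y Y' : connection nabla ->
  u *: Y = u *: Y' -> u *: nabla X Y = u *: nabla X Y'.
Proof.
move=> [_ _ nM] uYY; apply/eqP; rewrite -subr_eq0 -scalerBr; apply/eqP.
apply: vfield_sqr_cancel; have := congr1 (nabla X) uYY.
rewrite !nM => /(congr1 ( *:%R u)); rewrite !scalerDr !scalerA.
rewrite ![u * X u]mulrC -!scalerA uYY => /addrI uu.
by rewrite uu !scalerN subrr.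
Qed.

Lemma connection_locall nabla u X X' Y : connection nabla ->
  u *: X = u *: X' -> u *: nabla X Y = u *: nabla X' Y.
Proof.
move=> [nl _ _] uXX.
by rewrite -!(vf_linearZ _ _ (nl Y)) uXX.
Qed.

Lemma lie_bracketC X Y : lie_bracket X Y = - lie_bracket Y X.
Proof. by apply: vfield_ext => f; exact/esym/opprB. Qed.

Lemma lie_bracketXX X : lie_bracket X X = 0.
Proof. by apply: vfield_ext => f; exact: subrr. Qed.

Lemma lie_bracketDr X Y Z :
  lie_bracket X (Y + Z) = lie_bracket X Y + lie_bracket X Z.
Proof.
apply: vfield_ext => f; rewrite /lie_bracket /= vfieldD opprD.
exact: addrACA.
Qed.

Lemma lie_bracketZr X a Y :
  lie_bracket X (cstf a *: Y) = cstf a *: lie_bracket X Y.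
Proof.
apply: vfield_ext => f; rewrite [LHS]/= [X (_ * _)]vfieldM vfield_cst mulr0.
rewrite addr0; exact/esym/mulrBr.
Qed.

Lemma lie_bracketDl X Y Z :
  lie_bracket (X + Y) Z = lie_bracket X Z + lie_bracket Y Z.
Proof. by rewrite lie_bracketC lie_bracketDr opprD -!lie_bracketC. Qed.

Lemma lie_bracketZl X a Y :
  lie_bracket (cstf a *: X) Y = cstf a *: lie_bracket X Y.
Proof. by rewrite lie_bracketC lie_bracketZr -scalerN -lie_bracketC. Qed.

(** The terms X (g Y Z) of the general formula are absent, g being constant on
    X, Y, Z; metric compatibility then says that g (nabla U V) W is skew in V
    and W. *)
Lemma koszul (g : VF -> VF -> sfun) nabla X Y Z a b c :
  lorentzian g -> levi_civita g nabla ->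
  g X Y = cstf a -> g Y Z = cstf b -> g Z X = cstf c ->
  2%:R * g (nabla X Y) Z =
    g (lie_bracket X Y) Z - g (lie_bracket Y Z) X + g (lie_bracket Z X) Y.
Proof.
move=> [[gl gr] gC _] [_ tf mc] gXY gYZ gZX.
have gB U V W : g (U - V) W = g U W - g V W.
  rewrite (covecD _ _ (gr W)) -scaleN1r (covecZ _ _ (gr W)).
  by rewrite mulN1r.
have skew U V W d : g V W = cstf d -> g (nabla U V) W = - g (nabla U W) V.
  move=> gVW; have := mc U V W; rewrite /nabla02 gVW vfield_cst sub0r.
  by move=> /eqP; rewrite subr_eq0 [g V _]gC => /eqP <-; rewrite opprK.
rewrite -!tf !gB.
rewrite [g (nabla X Z) Y](skew _ _ _ b) 1?gC//.
rewrite [g (nabla Y Z) X](skew _ _ _ c)//.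
rewrite [g (nabla Z Y) X](skew _ _ _ a) 1?gC//.
ring.
Qed.

End Locality.

(** * The geometry of the Lie algebra in coordinates *)

Section Model.
Context {R : realType} (alpha beta : R).
(* The triple (x1, x2, x3) stands for x1 e1 + x2 e2 + x3 e3. *)
Local Notation vec := (R * R * R)%type.
Implicit Types x y z : vec.

Definition dotv x y : R := x.1.1 * y.1.1 + x.1.2 * y.1.2 - x.2 * y.2.

Definition subv x y : vec := (x.1.1 - y.1.1, x.1.2 - y.1.2, x.2 - y.2).

Definition bracketv x y : vec :=
  let p12 := x.1.1 * y.1.2 - x.1.2 * y.1.1 in
  let p13 := x.1.1 * y.2 - x.2 * y.1.1 in
  let p23 := x.1.2 * y.2 - x.2 * y.1.2 in
  (alpha * p12 - alpha * p13 + beta * p23,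
   - (beta * p13) + alpha * p23,
   - (beta * p12) + alpha * p23).

Definition levi_civitav x y : vec :=
  (alpha * x.1.1 * (y.1.2 - y.2) + 2^-1 * beta * (x.1.2 * y.2 - x.2 * y.1.2),
   alpha * ((x.1.2 - x.2) * y.2 - x.1.1 * y.1.1)
     + 2^-1 * beta * (x.2 * y.1.1 - x.1.1 * y.2),
   alpha * ((x.1.2 - x.2) * y.1.2 - x.1.1 * y.1.1)
     + 2^-1 * beta * (x.1.2 * y.1.1 - x.1.1 * y.1.2)).

Definition productv x : vec := (x.1.1, x.1.2, - x.2).

(** The closed form that results from substituting [levi_civitav] and
    [productv] in the definition of the connection. *)
Definition kobayashi_nomizuv x y : vec :=
  (alpha * (x.2 * y.1.1 + x.1.1 * y.1.2) - beta * x.2 * y.1.2,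
   beta * x.2 * y.1.1 - alpha * (x.2 * y.1.2 + x.1.1 * y.1.1),
   alpha * x.1.2 * y.2).

Definition curvaturev x y z : vec :=
  subv (subv (kobayashi_nomizuv x (kobayashi_nomizuv y z))
             (kobayashi_nomizuv y (kobayashi_nomizuv x z)))
       (kobayashi_nomizuv (bracketv x y) z).

Definition ricciv x y : R :=
  - dotv (curvaturev x (1, 0, 0) y) (1, 0, 0)
  - dotv (curvaturev x (0, 1, 0) y) (0, 1, 0)
  + dotv (curvaturev x (0, 0, 1) y) (0, 0, 1).

Definition sym_ricciv x y : R := 2^-1 * (ricciv x y + ricciv y x).

Lemma sym_ricciv_matrix x y : sym_ricciv x y =
  - (alpha ^+ 2 + beta ^+ 2) * (x.1.1 * y.1.1 + x.1.2 * y.1.2)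
  + alpha * beta * (x.1.1 * y.1.2 + x.1.2 * y.1.1)
  - 2^-1 * alpha * beta * (x.1.1 * y.2 + x.2 * y.1.1)
  + 2^-1 * alpha ^+ 2 * (x.1.2 * y.2 + x.2 * y.1.2).
Proof.
case: x y => [[x1 x2] x3] [[y1 y2] y3].
cbv [sym_ricciv ricciv dotv curvaturev kobayashi_nomizuv bracketv subv fst snd].
by field.
Qed.

(** The terms X (r Y Z) of the covariant derivative do not appear: r is constant
    on constant vectors. *)
Lemma codazzi_defect_e1_e3 :
  let e1 : vec := (1, 0, 0) in let e3 : vec := (0, 0, 1) in
  let K := kobayashi_nomizuv in let r := sym_ricciv in
  - r (K e1 e3) e1 - r e3 (K e1 e1) - (- r (K e3 e1) e1 - r e1 (K e3 e1))
  = - (3 / 2 * alpha ^+ 3).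
Proof.
by cbv zeta; rewrite !sym_ricciv_matrix /kobayashi_nomizuv /=; field.
Qed.

End Model.

(** * Transfer from coordinates to vector fields *)

Section Frame.
Context {R : realType} {M : manifoldType R 3} (alpha beta : R).
Local Notation sfun := (smoothfun M).
Local Notation VF := (vfield M).
Local Notation vec := (R * R * R)%type.
Context (g : VF -> VF -> sfun) (g_lorentz : lorentzian g).
Context (e1 e2 e3 : VF).
Context (g11 : g e1 e1 = 1) (g22 : g e2 e2 = 1) (g33 : g e3 e3 = -1)
    (g12 : g e1 e2 = 0) (g13 : g e1 e3 = 0) (g23 : g e2 e3 = 0)
    (e12 : lie_bracket e1 e2 = cstf alpha *: e1 - cstf beta *: e3)
    (e13 : lie_bracket e1 e3 = - (cstf alpha *: e1) - cstf beta *: e2)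
    (e23 : lie_bracket e2 e3 = cstf beta *: e1 + cstf alpha *: e2 + cstf alpha *: e3)
    (nablaL : VF -> VF -> VF)
    (nablaL_LC : levi_civita g nablaL)
    (J : VF -> VF) (J_prod : product_structure J)
    (J1 : J e1 = e1) (J2 : J e2 = e2) (J3 : J e3 = - e3).

Definition comb (x : vec) : VF :=
  cstf x.1.1 *: e1 + cstf x.1.2 *: e2 + cstf x.2 *: e3.

Lemma combB x y : comb x - comb y = comb (subv x y).
Proof.
rewrite /comb /= !cstfD !cstfN !scalerBl !opprD addrACA.
by rewrite [in LHS](addrACA (cstf x.1.1 *: e1)).
Qed.

Lemma combZ a x : cstf a *: comb x = comb (a * x.1.1, a * x.1.2, a * x.2).
Proof. by rewrite /comb /= !cstfM !scalerDr !scalerA. Qed.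

Lemma comb1 : comb (1, 0, 0) = e1.
Proof. by rewrite /comb /= cstf0 cstf1 scale1r !scale0r !addr0. Qed.
Lemma comb2 : comb (0, 1, 0) = e2.
Proof. by rewrite /comb /= cstf0 cstf1 scale1r !scale0r addr0 add0r. Qed.
Lemma comb3 : comb (0, 0, 1) = e3.
Proof. by rewrite /comb /= cstf0 cstf1 scale1r !scale0r !add0r. Qed.

Lemma productE x : J (comb x) = comb (productv x).
Proof.
have [Jl _ _] := J_prod.
rewrite /comb !(vf_linearD _ _ Jl) !(vf_linearZ _ _ Jl) J1 J2 J3.
by rewrite cstfN scalerN scaleNr.
Qed.

Lemma metricE x y : g (comb x) (comb y) = cstf (dotv x y).
Proof.
have [[gl gr] gC _] := g_lorentz.
rewrite /comb.
rewrite !(covecD _ _ (gr _)) !(covecZ _ _ (gr _)).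
rewrite !(covecD _ _ (gl _)) !(covecZ _ _ (gl _)).
rewrite (gC e2 e1) (gC e3 e1) (gC e3 e2) g11 g22 g33 g12 g13 g23.
rewrite /dotv !(cstfD, cstfN, cstfM); ring.
Qed.

Lemma bracketE x y :
  lie_bracket (comb x) (comb y) = comb (bracketv alpha beta x y).
Proof.
case: x y => [[x1 x2] x3] [[y1 y2] y3]; cbv [comb bracketv fst snd].
rewrite !(lie_bracketDl, lie_bracketZl) !(lie_bracketDr, lie_bracketZr).
rewrite (lie_bracketC e2 e1) (lie_bracketC e3 e1) (lie_bracketC e3 e2).
rewrite !lie_bracketXX e12 e13 e23; apply: vfield_ext => f.
rewrite !(vfield_addE, vfield_oppE, vfield_scaleE) !(cstfD, cstfN, cstfM).
rewrite (_ : (0 : VF) f = 0)//; ring.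
Qed.

(** Koszul's formula only yields products with the frame; recovering the field
    itself is the role of the expansion up to the factor u. *)
Lemma levi_civitaE x y k : g (nablaL (comb x) (comb y)) (comb k)
  = cstf (dotv (levi_civitav alpha beta x y) k).
Proof.
have := koszul g_lorentz nablaL_LC (metricE x y) (metricE y k) (metricE k x).
rewrite !bracketE !metricE -cstfN -!cstfD => K2.
have -> : g (nablaL (comb x) (comb y)) (comb k) =
    cstf 2^-1 * (2%:R * g (nablaL (comb x) (comb y)) (comb k)).
  have h2 : cstf 2^-1 * 2%:R = 1 :> sfun.
    by apply: sfunP => p; rewrite -[RHS](@mulVf R 2%:R)// pnatr_eq0.
  by rewrite mulrA h2 mul1r.
rewrite K2 -cstfM; congr cstf.
by rewrite /dotv /bracketv /levi_civitav /=; field.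
Qed.

Context (u : sfun) (frame : forall X : VF,
  u *: X = u *: (g X e1 *: e1 + g X e2 *: e2 - g X e3 *: e3)).

(** Where u does not vanish, X has the constant coordinates x in the frame. *)
Definition coords X x := u *: X = u *: comb x.

Lemma coords_sub X Y x y : coords X x -> coords Y y ->
  coords (X - Y) (subv x y).
Proof. by rewrite /coords => hX hY; rewrite -combB !scalerBr hX hY. Qed.

Lemma coords_scale a X x : coords X x ->
  coords (cstf a *: X) (a * x.1.1, a * x.1.2, a * x.2).
Proof.
have swap (W : VF) : u *: (cstf a *: W) = cstf a *: (u *: W).
  by rewrite !scalerA mulrC.
by rewrite /coords -combZ (swap X) (swap (comb x)) => ->.
Qed.

Lemma coords_product X x : coords X x -> coords (J X) (productv x).
Proof.
have [Jl _ _] := J_prod.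
by rewrite /coords => hX; rewrite -productE -!(vf_linearZ _ _ Jl) hX.
Qed.

Lemma coords_levi_civita X Y x y : coords X x -> coords Y y ->
  coords (nablaL X Y) (levi_civitav alpha beta x y).
Proof.
have [cL _ _] := nablaL_LC.
move=> hX hY; rewrite /coords (connection_locall _ cL hX).
rewrite (connection_localr _ cL hY) frame; congr (_ *: _).
rewrite -[X in g _ X *: _]comb1 -[X in _ + g _ X *: _ - _]comb2.
rewrite -[X in _ - g _ X *: _]comb3 !levi_civitaE /comb /dotv /=.
rewrite !(mulr1, mulr0, addr0, add0r, subr0, sub0r) !cstfN scaleNr opprK.
by [].
Qed.

Lemma coords_metric X Y x y : coords X x -> coords Y y ->
  u * g X Y = u * cstf (dotv x y).
Proof.
have [[gl gr] gC _] := g_lorentz.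
move=> hX hY; rewrite -(covecZ _ _ (gr Y)) hX (covecZ _ _ (gr Y)).
by rewrite -(covecZ _ _ (gl _)) hY (covecZ _ _ (gl _)) metricE.
Qed.

Local Notation nablak := (kobayashi_nomizu nablaL J).
Local Notation K := (kobayashi_nomizuv alpha beta).

Lemma coords_kobayashi_nomizu X Y x y : coords X x -> coords Y y ->
  coords (nablak X Y) (K x y).
Proof.
move=> hX hY.
have h11 Z W z w : coords Z z -> coords W w -> coords (nabla11 nablaL J Z W)
    (subv (levi_civitav alpha beta z (productv w))
          (productv (levi_civitav alpha beta z w))).
  move=> hZ hW; apply: coords_sub; last exact/coords_product/coords_levi_civita.
  by apply: coords_levi_civita => //; exact: coords_product.
have hJX := coords_product hX; have hJY := coords_product hY.
have := coords_sub (coords_sub (coords_levi_civita hX hY)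
    (coords_scale 2^-1 (h11 _ _ _ _ hX hJY)))
  (coords_scale 4^-1 (coords_sub (h11 _ _ _ _ hY hJX) (h11 _ _ _ _ hJY hX))).
rewrite /coords /nablak /canonical_connection => ->; congr (_ *: comb _).
rewrite /levi_civitav /productv /kobayashi_nomizuv.
congr (_, _, _) => /=; by field.
Qed.

Lemma coords_bracket X Y x y : coords X x -> coords Y y ->
  coords (lie_bracket X Y) (bracketv alpha beta x y).
Proof.
have [_ tf _] := nablaL_LC; move=> hX hY; rewrite -tf.
have := coords_sub (coords_levi_civita hX hY) (coords_levi_civita hY hX).
rewrite /coords => ->; congr (_ *: comb _).
by rewrite /levi_civitav /bracketv; congr (_, _, _) => /=; by field.
Qed.

Lemma coords_curvature X Y Z x y z : coords X x -> coords Y y -> coords Z z ->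
  coords (curvature nablak X Y Z) (curvaturev alpha beta x y z).
Proof.
move=> hX hY hZ; apply: coords_sub; first apply: coords_sub.
- by do 2!apply: coords_kobayashi_nomizu => //.
- by do 2!apply: coords_kobayashi_nomizu => //.
- by apply: coords_kobayashi_nomizu => //; exact: coords_bracket.
Qed.

Lemma coords_e1 : coords e1 (1, 0, 0). Proof. by rewrite /coords comb1. Qed.
Lemma coords_e2 : coords e2 (0, 1, 0). Proof. by rewrite /coords comb2. Qed.
Lemma coords_e3 : coords e3 (0, 0, 1). Proof. by rewrite /coords comb3. Qed.

Lemma coords_ricci X Y x y : coords X x -> coords Y y ->
  u * ricci g nablak e1 e2 e3 X Y = u * cstf (ricciv alpha beta x y).
Proof.
move=> hX hY; have hg Z z : coords Z z -> u * g (curvature nablak X Z Y) Z =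
    u * cstf (dotv (curvaturev alpha beta x z y) z).
  by move=> hZ; apply: coords_metric => //; exact: coords_curvature.
rewrite /ricci !mulrDr !mulrN.
rewrite (hg _ _ coords_e1) (hg _ _ coords_e2) (hg _ _ coords_e3).
by rewrite -!mulrN -!mulrDr -!cstfN -!cstfD.
Qed.

Lemma coords_sym_ricci X Y x y : coords X x -> coords Y y ->
  u * sym_ricci g nablak e1 e2 e3 X Y = u * cstf (sym_ricciv alpha beta x y).
Proof.
move=> hX hY; have half (a b : sfun) (c d : R) : u * a = u * cstf c ->
    u * b = u * cstf d -> u * (2^-1 *: (a + b)) = u * cstf (2^-1 * (c + d)).
  by move=> ac bd; rewrite cstfZ cstfM cstfD mulrCA mulrDr ac bd -mulrDr mulrCA.
exact: half (coords_ricci hX hY) (coords_ricci hY hX).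
Qed.

(** Where u does not vanish, omega Y Z is constant, so that its derivative does
    not contribute. *)
Lemma coords_nabla02 (nabla : VF -> VF -> VF) nablav (omega : VF -> VF -> sfun)
    omegav :
  (forall X Y x y, coords X x -> coords Y y ->
     coords (nabla X Y) (nablav x y)) ->
  (forall X Y x y, coords X x -> coords Y y ->
     u * omega X Y = u * cstf (omegav x y)) ->
  forall X Y Z x y z, coords X x -> coords Y y -> coords Z z ->
    u * nabla02 nabla omega X Y Z =
    u * cstf (- omegav (nablav x y) z - omegav y (nablav x z)).
Proof.
move=> hn ho X Y Z x y z hX hY hZ; rewrite /nabla02 !mulrBr.
rewrite (vfield_local _ (ho _ _ _ _ hY hZ)) vfield_cst mulr0 sub0r.
rewrite (ho _ _ _ _ (hn _ _ _ _ hX hY) hZ) (ho _ _ _ _ hY (hn _ _ _ _ hX hZ)).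
by rewrite cstfD !cstfN mulrDr !mulrN.
Qed.

Lemma codazzi_obstruction : codazzi nablak (sym_ricci g nablak e1 e2 e3) ->
  u * cstf (- (3 / 2 * alpha ^+ 3)) = 0.
Proof.
have hr := coords_nabla02 coords_kobayashi_nomizu coords_sym_ricci.
have diff (a b : sfun) (c d : R) : a - b = 0 -> u * a = u * cstf c ->
    u * b = u * cstf d -> u * cstf (c - d) = 0.
  by move=> ab uc ud; rewrite cstfD cstfN mulrBr -uc -ud -mulrBr ab mulr0.
move=> cod; rewrite -(codazzi_defect_e1_e3 _ beta).
exact: diff (cod e1 e3 e1) (hr _ _ _ _ _ _ coords_e1 coords_e3 coords_e1)
  (hr _ _ _ _ _ _ coords_e3 coords_e1 coords_e1).
Qed.

End Frame.

(** * The Codazzi equation fails *)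

Unset Implicit Arguments.
Unset Printing Implicit Defensive.

Theorem theorem4p4 (R : realType) (alpha beta : R) (halpha : alpha != 0)
    (G : lieGroupType R 3)
    (Gconn : connected [set: G]) (Gsc : simply_connected R G)
    (g : vfield G -> vfield G -> smoothfun G)
    (g_lorentz : lorentzian g) (g_inv : left_invariant_metric g)
    (e1 e2 e3 : vfield G)
    (e_basis : lie_algebra_basis [tuple e1; e2; e3])
    (g11 : g e1 e1 = 1) (g22 : g e2 e2 = 1) (g33 : g e3 e3 = -1)
    (g12 : g e1 e2 = 0) (g13 : g e1 e3 = 0) (g23 : g e2 e3 = 0)
    (e12 : lie_bracket e1 e2 = cstf alpha *: e1 - cstf beta *: e3)
    (e13 : lie_bracket e1 e3 = - (cstf alpha *: e1) - cstf beta *: e2)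
    (e23 : lie_bracket e2 e3 = cstf beta *: e1 + cstf alpha *: e2 + cstf alpha *: e3)
    (nablaL : vfield G -> vfield G -> vfield G)
    (nablaL_LC : levi_civita g nablaL)
    (J : vfield G -> vfield G) (J_prod : product_structure J)
    (J1 : J e1 = e1) (J2 : J e2 = e2) (J3 : J e3 = - e3) :
  let nablak := kobayashi_nomizu nablaL J in
  ~ codazzi nablak (sym_ricci g nablak e1 e2 e3).
Proof.
move=> nablak cod.
pose E (i : 'I_3) : vfield G := nth 0 [:: e1; e2; e3] i.
have [_ gC _] := g_lorentz.
have gE i j : g (E i) (E j) = if i == j then cstf (lorentz_sign i) else 0.
  case: i => [[|[|[|i]]] ilt] //; case: j => [[|[|[|j]]] jlt] //;
    rewrite /E /lorentz_sign /= ?cstfN ?cstf1 //; by rewrite gC.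
have [u [u0 uE]] := orthonormal_expansion (1%g : G) g_lorentz gE.
have frame X : u *: X = u *: (g X e1 *: e1 + g X e2 *: e2 - g X e3 *: e3).
  rewrite {1}uE !big_ord_recl big_ord0 addr0 /E /lorentz_sign /=.
  by rewrite cstfN cstf1 !mul1r mulN1r scaleNr addrA.
have uc := codazzi_obstruction g_lorentz g11 g22 g33 g12 g13 g23 e12 e13 e23
  nablaL_LC J_prod J1 J2 J3 frame cod.
have c0 : - (3 / 2 * alpha ^+ 3) != 0.
  by rewrite oppr_eq0 !mulf_neq0 ?expf_neq0 ?invr_eq0 ?pnatr_eq0.
apply: u0; apply: sfunP => p; apply/eqP; have /eqP := congr1 (evalp p) uc.
by rewrite rmorphM mulf_eq0 (negbTE (c0 : evalp p (cstf _) != 0)) orbF.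
Qed.
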